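(* Let $f:\mathbb{R}^n\to\mathbb{R}$ be $L$-smooth and $\mu$-strongly convex with $\mu>0$, twice differentiable with $H$-Lipschitz Hessian, with minimizer $x^\star$, and let $\kappa=L/\mu$. Let $\mathcal{P}\subseteq\mathbb{R}^{n\times n}$ be a closed convex set with $0\in\mathcal{P}$, $L^{-1}I\in\mathcal{P}$, $\operatorname{diam}(\mathcal{P})\le D<\infty$, and suppose $[\nabla^2 f(x^\star)]^{-1}\in\mathcal{P}$. Let $K\ge1$ and let $x^1,\dots,x^{K+1}$ be generated by the Hypergradient Descent Method (HDM, see context) with constant stepsize $\eta_k\equiv\frac{D}{(LD+1)\sqrt K}$, and put $\rho_K:=D(LD+1)\sqrt K$. Then $$f(x^{K+1})-f(x^\star)\le (f(x^1)-f(x^\star))\Big(\min\Big\{\frac{H^2\kappa^2}{4\mu^2K}\sum_{k=1}^K\|x^k-x^\star\|^2+\frac{2L\rho_K}{K},\ 1\Big\}\Big)^K.$$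
   Context: $\|\cdot\|$ is the Euclidean norm, $\operatorname{diam}$ is taken in the Frobenius norm, $\Pi_{\mathcal{P}}$ is the orthogonal projection onto $\mathcal{P}$. $L$-smooth means $\nabla f$ is $L$-Lipschitz; $H$-Lipschitz Hessian means $\|\nabla^2f(x)-\nabla^2f(y)\|\le H\|x-y\|$ in operator norm. Hypergradient feedback: for $x\ne x^\star$ and $P\in\mathbb{R}^{n\times n}$, $$h_x(P):=\frac{f(x-P\nabla f(x))-f(x)}{\|\nabla f(x)\|^2},\qquad \nabla h_x(P)=-\frac{\nabla f(x-P\nabla f(x))\nabla f(x)^\top}{\|\nabla f(x)\|^2}.$$ HDM: given $x^1\in\mathbb{R}^n$ and $P_1\in\mathcal{P}$, for $k=1,2,\dots$ set $$x^{k+1}\in\operatorname{argmin}_{x\in\{x^k,\ x^k-P_k\nabla f(x^k)\}} f(x),\qquad P_{k+1}=\Pi_{\mathcal{P}}[P_k-\eta_k\nabla h_{x^k}(P_k)].$$ The iterates $x^1,\dots,x^K$ are assumed to differ from $x^\star$, so that the feedbacks are defined. *)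

(* Defs.v *)
From mathcomp Require Import all_boot all_order all_algebra.
From mathcomp Require Import all_classical all_reals all_analysis.
Import Order.TTheory GRing.Theory Num.Theory.
Import numFieldNormedType.Exports.

Set Implicit Arguments.
Unset Strict Implicit.
Unset Printing Implicit Defensive.

Local Open Scope classical_set_scope.
Local Open Scope ring_scope.

Definition argmin (R : realType) (T : Type) (S : set T) (g : T -> R) : set T :=
  [set x | S x /\ forall y, S y -> g x <= g y].

(* The Frobenius norm, which is the Euclidean norm on column vectors. It is
   not the library's [`|A|], which is the largest modulus of an entry. *)
Definition l2norm (R : realType) (m n : nat) (A : 'M[R]_(m, n)) : R :=
  Num.sqrt (\sum_i \sum_j A i j ^+ 2).

(* The operator norm induced by the Euclidean norms. *)
Definition opnorm (R : realType) (m n : nat) (A : 'M[R]_(m, n)) : R :=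
  sup [set l2norm (A *m v) | v in [set v : 'cV[R]_n | l2norm v <= 1]].

(* Extended-real valued, so that an unbounded set has diameter [+oo]. *)
Definition diam (R : realType) (m n : nat) (S : set 'M[R]_(m, n)) : \bar R :=
  ereal_sup [set (l2norm (A - B))%:E | A in S & B in S].

(* [B] is the orthogonal projection of [A] onto [S]: its nearest point in the
   Frobenius norm, which is unique when [S] is closed, convex and nonempty. *)
Definition is_proj (R : realType) (m n : nat) (S : set 'M[R]_(m, n))
    (A B : 'M[R]_(m, n)) : Prop :=
  argmin S (fun C => l2norm (A - C)) B.

(* Used both on R^n (with [n] rows and one column) and on square matrices. *)
Definition gradient (R : realType) (m n : nat) (g : 'M[R]_(m, n) -> R)
    (A : 'M[R]_(m, n)) : 'M[R]_(m, n) :=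
  \matrix_(i, j) 'D_(delta_mx i j) g A.

Definition hessian (R : realType) (n : nat) (f : 'cV[R]_n -> R)
    (x : 'cV[R]_n) : 'M[R]_n :=
  \matrix_(i, j) 'D_(delta_mx i 0) ('D_(delta_mx j 0) f) x.

Definition smooth (R : realType) (n : nat) (L : R) (f : 'cV[R]_n -> R) : Prop :=
  (forall x, differentiable f x) /\
  forall x y, l2norm (gradient f x - gradient f y) <= L * l2norm (x - y).

Definition twice_differentiable (R : realType) (n : nat)
    (f : 'cV[R]_n -> R) : Prop :=
  (forall x, differentiable f x) /\ forall x, differentiable (gradient f) x.

Definition lipschitz_hessian (R : realType) (n : nat) (H : R)
    (f : 'cV[R]_n -> R) : Prop :=
  forall x y, opnorm (hessian f x - hessian f y) <= H * l2norm (x - y).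

Definition strongly_convex (R : realType) (n : nat) (mu : R)
    (f : 'cV[R]_n -> R) : Prop :=
  forall (x y : 'cV[R]_n) (t : R), 0 <= t <= 1 ->
    f (t *: x + (1 - t) *: y) <=
    t * f x + (1 - t) * f y - mu / 2 * t * (1 - t) * l2norm (x - y) ^+ 2.

Definition feedback (R : realType) (n : nat) (f : 'cV[R]_n -> R)
    (x : 'cV[R]_n) (P : 'M[R]_n) : R :=
  (f (x - P *m gradient f x) - f x) / l2norm (gradient f x) ^+ 2.

Lemma gradient_feedback (R : realType) (n : nat) (f : 'cV[R]_n -> R)
    (x : 'cV[R]_n) (P : 'M[R]_n) :
  (forall y, differentiable f y) ->
  gradient (feedback f x) P =
  - (l2norm (gradient f x) ^+ 2)^-1 *:
    (gradient f (x - P *m gradient f x) *m (gradient f x)^T).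
Proof.
move=> df; apply/matrixP => i j; rewrite !mxE big_ord1 !mxE.
set g := gradient f x; set c := (_ ^+ 2)^-1.
pose F (Q : 'M[R]_n) : R := f (x - Q *m g).
have shiftE (v : 'M[R]_n) (h : R) :
    (F \o shift P) (h *: v) = (f \o shift (x - P *m g)) (h *: - (v *m g)).
  by rewrite /F /= mulmxDl opprD addrCA scalerN -scalemxAl.
have dE (v : 'M[R]_n) : 'D_v F P = 'D_(- (v *m g)) f (x - P *m g).
  by rewrite /derive; under eq_fun do rewrite shiftE.
have dF (v : 'M[R]_n) : derivable F P v.
  rewrite /derivable; under eq_fun do rewrite shiftE.
  exact: diff_derivable.
have -> : feedback f x = c *: (F - cst (f x)).
  by apply/funext => Q; rewrite /feedback mulrC.
rewrite deriveZ; last by apply: derivableB => //; exact: derivable_cst.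
rewrite deriveB// derive_cst subr0 dE.
have -> : - (delta_mx i j *m g) = - g j 0 *: delta_mx i 0.
  apply/matrixP => a b; rewrite !mxE (ord1 b) (bigD1 j)//= big1 ?addr0.
    by rewrite !mxE !eqxx !andbT mulrC mulNr.
  by move=> l lj; rewrite !mxE (negbTE lj) andbF mul0r.
rewrite (deriveE _ (df _)) linearZ /= -(deriveE _ (df _)).
rewrite !mxE /GRing.scale/= !mulNr mulrN; congr (- (_ * _)).
exact: mulrC.
Qed.

(* Indices start at 1; only the steps [k = 1, ..., K] are constrained. *)
Definition HDM (R : realType) (n : nat) (f : 'cV[R]_n -> R)
    (PP : set 'M[R]_n) (eta : nat -> R) (K : nat)
    (x : nat -> 'cV[R]_n) (P : nat -> 'M[R]_n) : Prop :=
  PP (P 1%N) /\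
  forall k : nat, (1 <= k <= K)%N ->
    argmin [set x k; x k - P k *m gradient f (x k)] f (x k.+1) /\
    is_proj PP (P k - eta k *: gradient (feedback f (x k)) (P k)) (P k.+1).

(* Main.v *)
Require Import Defs.
From mathcomp Require Import all_boot all_order all_algebra.
From mathcomp Require Import all_classical all_reals all_analysis.
From mathcomp Require Import ring lra.
Import Order.TTheory GRing.Theory Num.Theory.
Import numFieldNormedType.Exports.
Local Open Scope classical_set_scope.
Local Open Scope ring_scope.

(** Let [gap y] be f(y) - f(x* ), and write g for the gradient at the current
    iterate x.  The quantity that the argument follows is the rate

      [rate M = gap (x - M g) / |g|^2],

    which differs from the feedback h_x(M) by gap(x) / |g|^2, a term that does
    not depend on M.  Hence the online learner that plays the matrices P_k
    against the losses h_{x^k} has the same regret against a fixed matrix Q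
    whether it is measured with feedbacks or with rates.  The feedback is
    convex in M because f is, and its gradient has Frobenius norm at most
    LD + 1 on the feasible set, since |grad f(x - Mg)| <= |g| + L|Mg|.
    Projected gradient steps of the prescribed length therefore have regret at
    most rho = D(LD + 1)sqrt K ([projected_gradient_regret]).

    The comparator is Q = (Hess f(x* ))^-1.  The step x - Qg is an approximate
    Newton step: it lands within (H / 2 mu)|x - x*|^2 of x* ([newton_step_le]),
    so the rate of Q is of order |x - x*|^2 ([newton_rate]).

    Finally |g|^2 <= 2L gap(x), and the iterate never increases f, so one step
    multiplies the gap by at most min(2L rate, 1).  By the arithmetic-geometric
    mean inequality the product of these K factors is at most the K-th power of
    their average ([prod_rates_le]), and the average is bounded both by 1 and,
    through the regret bound, by 2L times the sum of rho / K and the average of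
    the comparator's rates.

    The factor by which a step shrinks the gap is the rate times |g|^2 / gap(x),
    and these weights vary with k, so the regret cannot be summed against them
    directly.  Normalizing by |g|^2 avoids this: the weights, which lie between
    2 mu and 2L, enter once as 2L in front of the summed rates and once as
    1 / 2 mu in the rate of the comparator.  Their ratio is one of the two factors
    L / mu in the result; the other is the ratio of the quadratic upper and
    lower bounds on the gap.

    The Newton estimate needs the Hessian matrix, whose (i, j) entry is a
    partial derivative in direction i of the j-th partial derivative, to act on
    vectors as the derivative of the gradient; this is its symmetry, which
    comes from the two ways of writing a second difference of f
    ([hessian_form_sym]). *)

(** * The Frobenius inner product *)

Definition frob {R : realType} {m n : nat} (A B : 'M[R]_(m, n)) : R :=
  \tr (A^T *m B).

Lemma frobC {R : realType} {m n : nat} (A B : 'M[R]_(m, n)) :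
  frob A B = frob B A.
Proof. by rewrite /frob -mxtrace_tr trmx_mul trmxK. Qed.

Lemma frobDr {R : realType} {m n : nat} (A B C : 'M[R]_(m, n)) :
  frob A (B + C) = frob A B + frob A C.
Proof. by rewrite /frob mulmxDr linearD. Qed.

Lemma frobNr {R : realType} {m n : nat} (A B : 'M[R]_(m, n)) :
  frob A (- B) = - frob A B.
Proof. by rewrite /frob mulmxN linearN. Qed.

Lemma frobZr {R : realType} {m n : nat} (c : R) (A B : 'M[R]_(m, n)) :
  frob A (c *: B) = c * frob A B.
Proof. by rewrite /frob -scalemxAr linearZ. Qed.

Lemma frobDl {R : realType} {m n : nat} (A B C : 'M[R]_(m, n)) :
  frob (A + B) C = frob A C + frob B C.
Proof. by rewrite !(frobC _ C) frobDr. Qed.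

Lemma frobNl {R : realType} {m n : nat} (A B : 'M[R]_(m, n)) :
  frob (- A) B = - frob A B.
Proof. by rewrite !(frobC _ B) frobNr. Qed.

Lemma frobZl {R : realType} {m n : nat} (c : R) (A B : 'M[R]_(m, n)) :
  frob (c *: A) B = c * frob A B.
Proof. by rewrite !(frobC _ B) frobZr. Qed.

Lemma frob0l {R : realType} {m n : nat} (A : 'M[R]_(m, n)) : frob 0 A = 0.
Proof. by rewrite /frob trmx0 mul0mx mxtrace0. Qed.

Definition frobE := (@frobDl, @frobDr, @frobNl, @frobNr, @frobZl, @frobZr).

Lemma frob_sum {R : realType} {m n : nat} (A B : 'M[R]_(m, n)) :
  frob A B = \sum_i \sum_j A i j * B i j.
Proof.
rewrite /frob /mxtrace exchange_big; apply: eq_bigr => j _.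
by rewrite mxE; apply: eq_bigr => i _; rewrite mxE.
Qed.

Lemma l2norm_ge0 {R : realType} {m n : nat} (A : 'M[R]_(m, n)) :
  0 <= l2norm A.
Proof. exact: sqrtr_ge0. Qed.

Lemma sqr_l2norm {R : realType} {m n : nat} (A : 'M[R]_(m, n)) :
  l2norm A ^+ 2 = frob A A.
Proof.
rewrite frob_sum sqr_sqrtr.
  by apply: eq_bigr => i _; apply: eq_bigr => j _; rewrite expr2.
by apply: sumr_ge0 => i _; apply: sumr_ge0 => j _; exact: sqr_ge0.
Qed.

Lemma l2norm_eq0 {R : realType} {m n : nat} (A : 'M[R]_(m, n)) :
  (l2norm A == 0) = (A == 0).
Proof.
apply/idP/idP => [|/eqP ->]; last first.
  by rewrite -sqrf_eq0 sqr_l2norm /frob mulmx0 mxtrace0.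
rewrite -sqrf_eq0 sqr_l2norm frob_sum => /eqP A0; apply/eqP/matrixP => i j.
have sq_ge0 i' j' : 0 <= A i' j' * A i' j' by rewrite -expr2 sqr_ge0.
have /psumr_eq0P rows0 : \sum_i \sum_j A i j * A i j = 0 by [].
have row0 : \sum_j A i j * A i j = 0.
  by apply: rows0 => // i' _; exact: sumr_ge0.
have /(_ j isT)/eqP := @psumr_eq0P _ _ _ _ (fun j' _ => sq_ge0 i j') row0.
by rewrite mulf_eq0 orbb mxE => /eqP.
Qed.

Lemma l2norm0 {R : realType} {m n : nat} : l2norm (0 : 'M[R]_(m, n)) = 0.
Proof. by apply/eqP; rewrite l2norm_eq0. Qed.

Lemma l2norm_gt0 {R : realType} {m n : nat} (A : 'M[R]_(m, n)) :
  (0 < l2norm A) = (A != 0).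
Proof. by rewrite lt_def l2norm_ge0 l2norm_eq0 andbT. Qed.

Lemma l2normZ {R : realType} {m n : nat} (c : R) (A : 'M[R]_(m, n)) :
  l2norm (c *: A) = `|c| * l2norm A.
Proof.
apply/eqP; rewrite -(@eqrXn2 _ 2) ?mulr_ge0 ?l2norm_ge0//.
by rewrite exprMn !sqr_l2norm !frobE real_normK ?num_real// mulrA expr2.
Qed.

Lemma l2normN {R : realType} {m n : nat} (A : 'M[R]_(m, n)) :
  l2norm (- A) = l2norm A.
Proof. by rewrite -scaleN1r l2normZ normrN1 mul1r. Qed.

Lemma frob_CauchySchwarz {R : realType} {m n : nat} (A B : 'M[R]_(m, n)) :
  frob A B <= l2norm A * l2norm B.
Proof.
have [->|B0] := eqVneq B 0.
  by rewrite /frob mulmx0 mxtrace0 mulr_ge0 ?l2norm_ge0.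
have b_gt0 : 0 < l2norm B by rewrite l2norm_gt0.
have [->|A0] := eqVneq A 0.
  by rewrite /frob trmx0 mul0mx mxtrace0 mulr_ge0 ?l2norm_ge0.
have a_gt0 : 0 < l2norm A by rewrite l2norm_gt0.
have := sqr_ge0 (l2norm (l2norm B *: A - l2norm A *: B)).
rewrite sqr_l2norm !frobE (frobC B A) -!sqr_l2norm.
set a := l2norm A in a_gt0 *; set b := l2norm B in b_gt0 *.
set c := frob A B => h.
have : 0 <= a * b * (a * b - c) by nra.
by rewrite pmulr_rge0 ?mulr_gt0// subr_ge0.
Qed.

Lemma l2normD {R : realType} {m n : nat} (A B : 'M[R]_(m, n)) :
  l2norm (A + B) <= l2norm A + l2norm B.
Proof.
rewrite -ler_sqr ?nnegrE ?addr_ge0 ?l2norm_ge0//.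
rewrite sqr_l2norm !frobE (frobC B A) -!sqr_l2norm.
by have := frob_CauchySchwarz A B; lra.
Qed.

Lemma frob_mulmxr {R : realType} {m n p : nat} (A : 'M[R]_(m, n))
    (B : 'M[R]_(n, p)) (C : 'M[R]_(m, p)) :
  frob (A *m B) C = frob A (C *m B^T).
Proof. by rewrite /frob trmx_mul -mulmxA mxtrace_mulC mulmxA. Qed.

(** The gradient of the feedback is a multiple of an outer product, so its
    Frobenius norm factors through two Euclidean norms. *)
Lemma l2norm_outer {R : realType} {m n : nat} (u : 'cV[R]_m) (v : 'cV[R]_n) :
  l2norm (u *m v^T) = l2norm u * l2norm v.
Proof.
apply/eqP; rewrite -(@eqrXn2 _ 2) ?mulr_ge0 ?l2norm_ge0// exprMn !sqr_l2norm.
rewrite frob_mulmxr trmxK -mulmxA [v^T *m v]mx11_scalar mul_mx_scalar frobZr mulrC.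
by rewrite [frob v v]/frob trace_mx11.
Qed.

(** Cauchy-Schwarz against the outer product of [A *m v] and [v]. *)
Lemma l2norm_mulmx {R : realType} {m n : nat} (A : 'M[R]_(m, n))
    (v : 'cV[R]_n) :
  l2norm (A *m v) <= l2norm A * l2norm v.
Proof.
have [->|Av0] := eqVneq (l2norm (A *m v)) 0; first by rewrite mulr_ge0 ?l2norm_ge0.
have Av_gt0 : 0 < l2norm (A *m v) by rewrite lt_def Av0 l2norm_ge0.
rewrite -(ler_pM2r Av_gt0) -expr2 sqr_l2norm frob_mulmxr.
by rewrite (le_trans (frob_CauchySchwarz _ _))// l2norm_outer -mulrA [l2norm v * _]mulrC.
Qed.

(** The supremum defining the operator norm is over a bounded set, by
    [l2norm_mulmx]; otherwise the value of [sup] would carry no information. *)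
Lemma l2norm_mulmx_opnorm {R : realType} {m n : nat} (A : 'M[R]_(m, n))
    (v : 'cV[R]_n) :
  l2norm (A *m v) <= opnorm A * l2norm v.
Proof.
have [->|v0] := eqVneq v 0; first by rewrite mulmx0 !l2norm0 mulr0.
have v_gt0 : 0 < l2norm v by rewrite l2norm_gt0.
rewrite -ler_pdivrMr//.
have -> : l2norm (A *m v) / l2norm v = l2norm (A *m ((l2norm v)^-1 *: v)).
  by rewrite -scalemxAr l2normZ mulrC ger0_norm// invr_ge0 ltW.
apply: ub_le_sup.
  exists (l2norm A) => _ /= [w w1 <-].
  by rewrite (le_trans (l2norm_mulmx _ _))// ler_piMr// l2norm_ge0.
exists ((l2norm v)^-1 *: v) => //=.
by rewrite l2normZ ger0_norm ?invr_ge0 ?(ltW v_gt0)// mulVf// gt_eqF.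
Qed.

(** * First- and second-order calculus *)

(** Replaces every passage to the limit below: an inequality with an error
    linear in the step size holds without the error. *)
Lemma le_of_small {R : realType} (a b c : R) :
  (forall t, 0 < t -> t <= 1 -> a <= b + t * c) -> a <= b.
Proof.
move=> le_t; apply/ler_addgt0Pr => e e_gt0.
have c1_gt0 : 0 < `|c| + 1 by rewrite ltr_wpDl.
have t_gt0 : 0 < Num.min 1 (e / (`|c| + 1)) by rewrite lt_min ltr01 divr_gt0.
apply: (le_trans (le_t _ t_gt0 _)); first by rewrite ge_min lexx.
rewrite lerD2l; apply: (le_trans (ler_wpM2l (ltW t_gt0) (ler_norm c))).
apply: (@le_trans _ _ (e / (`|c| + 1) * `|c|)).
  by apply: ler_wpM2r => //; rewrite ge_min lexx orbT.
by rewrite mulrAC ler_pdivrMr// ler_wpM2l ?(ltW e_gt0)// lerDl.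
Qed.

(** Both the quadratic upper bound for smooth functions and the quadratic error
    of the linearized gradient are instances: subtract from [phi] its expected
    quadratic upper bound, and the mean value theorem applies to a function
    whose derivative is nonpositive. *)
Lemma le_second_order {R : realType} (phi dphi : R -> R) (C : R) :
  (forall t : R, is_derive t 1 phi (dphi t)) ->
  (forall t : R, 0 < t -> dphi t <= dphi 0 + C * t) ->
  phi 1 <= phi 0 + dphi 0 + C / 2.
Proof.
move=> dphiE dphi_le.
pose psi : R -> R := phi - (dphi 0 *: id + (C / 2) *: (id ^+ 2)).
pose dpsi t := dphi t - (dphi 0 + C * t).
have psiE (t : R) : psi t = phi t - (dphi 0 * t + C / 2 * t ^+ 2) by [].
have dpsiE (t : R) : is_derive t 1 psi (dpsi t).
  have dlin := is_deriveZ (dphi 0) (is_derive_id t 1).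
  have dsqr := is_deriveZ (C / 2) (is_deriveX 2 (is_derive_id t 1)).
  apply: (is_derive_eq (is_deriveB (dphiE t) (is_deriveD dlin dsqr))).
  by rewrite /dpsi /GRing.scale /= !mulr1 expr1; field.
have psi_cts : {within `[0, 1], continuous psi}.
  by apply: derivable_within_continuous => t _; exact: ex_derive.
have [c c01] := MVT ltr01 (fun t _ => dpsiE t) psi_cts.
have {c01} c_gt0 : 0 < c by move: c01; rewrite in_itv /= => /andP[].
have := dphi_le c c_gt0.
rewrite !psiE /dpsi subr0 mulr1 expr0n expr1n /= => dphi_c psi_diff.
by lra.
Qed.

(** The difference quotients of [g] along the line and of [g] in the direction
    [d] are the same functions. *)
Lemma is_derive_line {R : realType} {V W : normedModType R} (g : V -> W)
    (x d : V) (t : R) :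
  derivable g (x + t *: d) d ->
  is_derive t 1 (fun s => g (x + s *: d)) ('D_d g (x + t *: d)).
Proof.
have quotE : (fun h : R => h^-1 *: (((fun s => g (x + s *: d)) \o shift t) (h *: 1)
      - g (x + t *: d))) =
    (fun h : R => h^-1 *: ((g \o shift (x + t *: d)) (h *: d) - g (x + t *: d))).
  apply/funext => h /=; congr (_ *: (g _ - _)).
  by rewrite scalerDl /GRing.scale /= mulr1 addrCA.
move=> dg; split; first by rewrite /derivable quotE.
by rewrite /derive quotE.
Qed.

Lemma derive_gradient {R : realType} {m n : nat} (g : 'M[R]_(m, n) -> R)
    (x d : 'M[R]_(m, n)) :
  differentiable g x -> 'D_d g x = frob (gradient g x) d.
Proof.
move=> dg; rewrite deriveE// [d in LHS]matrix_sum_delta linear_sum frob_sum.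
apply: eq_bigr => i _; rewrite linear_sum; apply: eq_bigr => j _.
by rewrite linearZ /= mxE deriveE// mulrC.
Qed.

Lemma is_derive_gradient_line {R : realType} {m n : nat} (g : 'M[R]_(m, n) -> R)
    (x d : 'M[R]_(m, n)) (t : R) :
  (forall y, differentiable g y) ->
  is_derive t 1 (fun s => g (x + s *: d)) (frob (gradient g (x + t *: d)) d).
Proof.
move=> dg; rewrite -derive_gradient//.
by apply: is_derive_line; exact: diff_derivable.
Qed.

Lemma mean_value_gradient {R : realType} {m n : nat} (g : 'M[R]_(m, n) -> R)
    (x d : 'M[R]_(m, n)) :
  (forall y, differentiable g y) ->
  exists2 c, 0 <= c <= 1 & g (x + d) - g x = frob (gradient g (x + c *: d)) d.
Proof.
move=> dg; have dline (t : R) := is_derive_gradient_line g x d t dg.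
have cts : {within `[0, 1], continuous (fun s => g (x + s *: d))}.
  by apply: derivable_within_continuous => t _; exact: ex_derive.
have [c] := MVT ltr01 (fun t _ => dline t) cts.
rewrite in_itv /= => /andP[/ltW c0 /ltW c1].
rewrite scale1r scale0r addr0 subr0 mulr1 => ->.
by exists c; rewrite ?c0.
Qed.

(** * Symmetry of the Hessian *)

Lemma differentiable_gradient_coord {R : realType} {n : nat}
    (f : 'cV[R]_n -> R) (y : 'cV[R]_n) (i : 'I_n) :
  differentiable (gradient f) y -> differentiable (fun z => gradient f z i 0) y.
Proof.
move=> df.
exact: (@differentiable_comp _ _ _ _ (gradient f) (fun M : 'cV[R]_n => M i 0) y
  df (differentiable_coord _ _ _)).
Qed.

Lemma differentiable_frob_gradient {R : realType} {n : nat} (f : 'cV[R]_n -> R)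
    (u y : 'cV[R]_n) :
  differentiable (gradient f) y ->
  differentiable (fun z => frob (gradient f z) u) y.
Proof.
move=> df.
have -> : (fun z => frob (gradient f z) u) =
    \sum_i (u i 0 *: (fun z => gradient f z i 0)).
  apply/funext => z; rewrite frob_sum fct_sumE; apply: eq_bigr => i _.
  by rewrite big_ord1 mulrC.
apply: differentiable_sum => i; apply: differentiableZ.
exact: differentiable_gradient_coord.
Qed.

(** The orientation of [hessian] matters here: row [i] collects the derivatives
    in direction [i], so the gradient of the function [frob (gradient f z) u] is
    the Hessian, and not its transpose, applied to [u]. *)
Lemma gradient_frob_gradient {R : realType} {n : nat} (f : 'cV[R]_n -> R)
    (u y : 'cV[R]_n) :
  differentiable (gradient f) y ->
  gradient (fun z => frob (gradient f z) u) y = hessian f y *m u.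
Proof.
move=> df; apply/matrixP => i j; rewrite (ord1 j) !mxE.
have -> : (fun z => frob (gradient f z) u) =
    \sum_l (u l 0 *: ('D_(delta_mx l 0) f)).
  apply/funext => z; rewrite frob_sum fct_sumE; apply: eq_bigr => l _.
  by rewrite big_ord1 mulrC mxE.
have dD l v : derivable ('D_(delta_mx l 0) f) y v.
  have -> : 'D_(delta_mx l 0) f = (fun z => gradient f z l 0).
    by apply/funext => z; rewrite mxE.
  by apply: diff_derivable; exact: differentiable_gradient_coord.
rewrite derive_sum; last by move=> l; exact: derivableZ.
by apply: eq_bigr => l _; rewrite deriveZ// mxE mulrC.
Qed.

Lemma differentiable_translate {R : realType} {V W : normedModType R}
    (g : V -> W) (v y : V) :
  differentiable g (y + v) -> differentiable (fun z => g (z + v)) y.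
Proof.
have dv : differentiable ((id : V -> V) + cst v) y.
  by apply: differentiableD => //; exact: differentiable_cst.
by move=> dg; exact: (@differentiable_comp _ _ _ _ _ g y dv dg).
Qed.

(** Apply the mean value theorem along [u] to the increment of [f] over [v], and
    then along [v] to the resulting directional derivative. *)
Lemma second_difference {R : realType} {n : nat} (f : 'cV[R]_n -> R)
    (x u v : 'cV[R]_n) :
  twice_differentiable f ->
  exists2 p : 'cV[R]_n, l2norm p <= l2norm u + l2norm v &
    f (x + u + v) - f (x + u) - f (x + v) + f x =
    frob (hessian f (x + p) *m u) v.
Proof.
move=> [df ddf].
have dfv y : differentiable (fun z => f (z + v) - f z) y.
  by apply: differentiableB => //; exact: differentiable_translate.
have gradB y : gradient (fun z => f (z + v) - f z) y =
    gradient f (y + v) - gradient f y.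
  apply/matrixP => i j; rewrite !mxE.
  have dfsv w : derivable (fun z => f (z + v)) y w.
    by apply: diff_derivable; exact: differentiable_translate.
  rewrite deriveB; [|exact: dfsv|exact: diff_derivable].
  congr (_ - _); rewrite /derive.
  by under eq_fun do rewrite /= -addrA.
have [a a01 fE] := mean_value_gradient (fun z => f (z + v) - f z) x u dfv.
have dG y := @differentiable_frob_gradient _ _ f u y (ddf y).
have [b b01 GE] :=
  mean_value_gradient (fun z => frob (gradient f z) u) (x + a *: u) v dG.
exists (a *: u + b *: v).
  move: a01 b01 => /andP[a0 a1] /andP[b0 b1]; apply: (le_trans (l2normD _ _)).
  by rewrite !l2normZ !ger0_norm// lerD// ler_piMl// l2norm_ge0.
have -> : f (x + u + v) - f (x + u) - f (x + v) + f x =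
  (f (x + u + v) - f (x + u)) - (f (x + v) - f x) by ring.
move: fE GE => /=; rewrite gradB frobDl frobNl => -> ->.
by rewrite gradient_frob_gradient ?[x + (_ + _)]addrA; last exact: ddf.
Qed.

Lemma hessian_form_lipschitz {R : realType} {n : nat} (H : R)
    (f : 'cV[R]_n -> R) (x y u v : 'cV[R]_n) :
  lipschitz_hessian H f ->
  frob (hessian f y *m u) v <=
  frob (hessian f x *m u) v + H * l2norm (y - x) * l2norm u * l2norm v.
Proof.
move=> fH; rewrite -lerBlDl -frobNl -frobDl -mulmxBl.
apply: (le_trans (frob_CauchySchwarz _ _)); apply: ler_wpM2r; first exact: l2norm_ge0.
apply: (le_trans (l2norm_mulmx_opnorm _ _)).
by apply: ler_wpM2r; [exact: l2norm_ge0|exact: fH].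
Qed.

(** The second difference of [f] over [u] and [v] does not depend on their
    order, so the Hessian at one nearby point, applied to [u], pairs with [v] as
    the Hessian at another nearby point, applied to [v], pairs with [u].  Moving
    both points to [x] costs the Lipschitz error. *)
Lemma hessian_form_near_sym {R : realType} {n : nat} (H : R)
    (f : 'cV[R]_n -> R) (x u v : 'cV[R]_n) :
  twice_differentiable f -> 0 <= H -> lipschitz_hessian H f ->
  frob (hessian f x *m u) v <= frob (hessian f x *m v) u +
    2 * H * (l2norm u + l2norm v) * l2norm u * l2norm v.
Proof.
have chain (a b c d E e : R) : a <= b + E -> b = c -> c <= d + E ->
  E + E = e -> a <= d + e by lra.
move=> f2 H0 fH.
have [p p_le uvE] := second_difference f x u v f2.
have [q q_le vuE] := second_difference f x v u f2.
pose E := H * (l2norm u + l2norm v) * l2norm u * l2norm v.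
have up : frob (hessian f x *m u) v <= frob (hessian f (x + p) *m u) v + E.
  apply: (le_trans (hessian_form_lipschitz H f (x + p) x u v fH)).
  rewrite lerD2l opprD addrA subrr add0r l2normN /E.
  by rewrite !ler_wpM2r ?l2norm_ge0// ler_wpM2l.
have down : frob (hessian f (x + q) *m v) u <= frob (hessian f x *m v) u + E.
  apply: (le_trans (hessian_form_lipschitz H f x (x + q) v u fH)).
  rewrite lerD2l addrAC subrr add0r /E -!mulrA [l2norm v * l2norm u]mulrC !mulrA.
  by rewrite !ler_wpM2r ?l2norm_ge0// ler_wpM2l// addrC.
have mid : frob (hessian f (x + p) *m u) v = frob (hessian f (x + q) *m v) u.
  apply: (etrans (esym uvE)); apply: (etrans _ vuE).
  by rewrite (addrAC x u); congr (_ + _); exact: addrAC.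
by apply: (chain _ _ _ _ _ _ up mid down); rewrite /E; ring.
Qed.

(** The error in [hessian_form_near_sym] is cubic in the size of the
    displacements and the form is quadratic, so shrinking them removes it. *)
Lemma hessian_form_sym {R : realType} {n : nat} (H : R) (f : 'cV[R]_n -> R)
    (x u v : 'cV[R]_n) :
  twice_differentiable f -> 0 <= H -> lipschitz_hessian H f ->
  frob (hessian f x *m u) v = frob (hessian f x *m v) u.
Proof.
move=> f2 H0 fH.
suff le (u' v' : 'cV[R]_n) :
    frob (hessian f x *m u') v' <= frob (hessian f x *m v') u'.
  by apply/eqP; rewrite eq_le !le.
apply: (@le_of_small _ _ _
  (2 * H * (l2norm u' + l2norm v') * l2norm u' * l2norm v')) => s s_gt0 _.
have := hessian_form_near_sym H f x (s *: u') (s *: v') f2 H0 fH.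
rewrite -!scalemxAr !frobE !l2normZ !(ger0_norm (ltW s_gt0)) => s_le.
rewrite -(ler_pM2l (mulr_gt0 s_gt0 s_gt0)).
by move: s_le; lra.
Qed.

(** * Smooth and strongly convex functions *)

Lemma smooth_upper_bound {R : realType} {n : nat} (L : R) (f : 'cV[R]_n -> R)
    (x d : 'cV[R]_n) :
  smooth L f ->
  f (x + d) <= f x + frob (gradient f x) d + L / 2 * l2norm d ^+ 2.
Proof.
move=> [df gL].
have := @le_second_order _ (fun s => f (x + s *: d))
  (fun s => frob (gradient f (x + s *: d)) d) (L * l2norm d ^+ 2)
  (fun t => is_derive_gradient_line f x d t df).
rewrite scale1r scale0r addr0 mulrAC; apply => t t_gt0.
rewrite -lerBlDl -frobNl -frobDl; apply: (le_trans (frob_CauchySchwarz _ _)).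
apply: (le_trans (ler_wpM2r (l2norm_ge0 d) (gL _ _))).
by rewrite addrAC subrr add0r l2normZ gtr0_norm//; lra.
Qed.

(** The convexity inequality on the short segment from [x] to [x + t d] bounds
    f(x + td) from above, and smoothness bounds it from below by its
    linearization up to an error of order t^2; dividing by t leaves the claim
    with an error of order t. *)
Lemma strongly_convex_lower_bound {R : realType} {n : nat} (L mu : R)
    (f : 'cV[R]_n -> R) (x d : 'cV[R]_n) :
  smooth L f -> strongly_convex mu f ->
  f x + frob (gradient f x) d + mu / 2 * l2norm d ^+ 2 <= f (x + d).
Proof.
move=> fL fmu.
apply: (@le_of_small _ _ _ ((3 * L + mu) / 2 * l2norm d ^+ 2)) => t t_gt0 t_le1.
have tD : l2norm (t *: d) = t * l2norm d by rewrite l2normZ gtr0_norm.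
(* The lower bound on f(x + td) is the smooth upper bound based at x + td. *)
have back := smooth_upper_bound L f (x + t *: d) (- (t *: d)) fL.
rewrite addrK frobNr l2normN tD frobZr in back.
have grad_le : frob (gradient f x) d - frob (gradient f (x + t *: d)) d <=
    L * (t * l2norm d) * l2norm d.
  rewrite -frobNl -frobDl; apply: (le_trans (frob_CauchySchwarz _ _)).
  rewrite ler_wpM2r ?l2norm_ge0//; apply: (le_trans (fL.2 _ _)).
  by rewrite opprD addrA subrr add0r l2normN tD.
have chord := fmu (x + d) x t; rewrite (ltW t_gt0) t_le1 in chord.
have combE : t *: (x + d) + (1 - t) *: x = x + t *: d.
  by rewrite scalerDr addrAC -scalerDl [t + _]addrC subrK scale1r.
rewrite combE [x + d - x]addrAC subrr add0r in chord.
rewrite -(ler_pM2l t_gt0); have := chord isT.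
have := ler_wpM2l (ltW t_gt0) grad_le.
move: back.
generalize (frob (gradient f x) d) (frob (gradient f (x + t *: d)) d)
 (f (x + t *: d)) (f x) (f (x + d)) (l2norm d) => a b c d0 e l.
lra.
Qed.

Lemma strongly_convex_first_order {R : realType} {n : nat} (L mu : R)
    (f : 'cV[R]_n -> R) (x d : 'cV[R]_n) :
  smooth L f -> 0 <= mu -> strongly_convex mu f ->
  f x + frob (gradient f x) d <= f (x + d).
Proof.
move=> fL mu_ge0 fmu.
apply: le_trans (strongly_convex_lower_bound L mu f x d fL fmu).
by rewrite lerDl mulr_ge0 ?divr_ge0 ?sqr_ge0.
Qed.

Lemma gradient_argmin {R : realType} {n : nat} (L : R) (f : 'cV[R]_n -> R)
    (x : 'cV[R]_n) :
  smooth L f -> argmin [set: 'cV[R]_n] f x -> gradient f x = 0.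
Proof.
move=> fL [_ x_min]; apply/eqP; rewrite -l2norm_eq0 -sqrf_eq0 eq_le sqr_ge0 andbT.
apply: (@le_of_small _ _ _ (L / 2 * l2norm (gradient f x) ^+ 2)) => t t_gt0 _.
rewrite -(ler_pM2l t_gt0).
have := smooth_upper_bound L f x (- (t *: gradient f x)) fL.
move=> /(le_trans (x_min _ I)).
rewrite frobNr l2normN frobZr l2normZ (gtr0_norm t_gt0) -sqr_l2norm.
by lra.
Qed.

Lemma gap_lower {R : realType} {n : nat} (L mu : R) (f : 'cV[R]_n -> R)
    (xstar x : 'cV[R]_n) :
  smooth L f -> strongly_convex mu f -> argmin [set: 'cV[R]_n] f xstar ->
  mu / 2 * l2norm (x - xstar) ^+ 2 <= f x - f xstar.
Proof.
move=> fL fmu x_min.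
have := strongly_convex_lower_bound L mu f xstar (x - xstar) fL fmu.
by rewrite (gradient_argmin _ _ _ fL x_min) frob0l subrKC; lra.
Qed.

Lemma gap_upper {R : realType} {n : nat} (L : R) (f : 'cV[R]_n -> R)
    (xstar x : 'cV[R]_n) :
  smooth L f -> argmin [set: 'cV[R]_n] f xstar ->
  f x - f xstar <= L / 2 * l2norm (x - xstar) ^+ 2.
Proof.
move=> fL x_min.
have := smooth_upper_bound L f xstar (x - xstar) fL.
by rewrite (gradient_argmin _ _ _ fL x_min) frob0l subrKC; lra.
Qed.

(** A gradient step of length 1 / L decreases [f] by |g|^2 / 2L, and cannot go
    below the minimum. *)
Lemma sqr_gradient_le_gap {R : realType} {n : nat} (L : R) (f : 'cV[R]_n -> R)
    (xstar x : 'cV[R]_n) :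
  0 < L -> smooth L f -> argmin [set: 'cV[R]_n] f xstar ->
  l2norm (gradient f x) ^+ 2 <= 2 * L * (f x - f xstar).
Proof.
move=> L_gt0 fL [_ x_min].
have := smooth_upper_bound L f x (- (L^-1 *: gradient f x)) fL.
move=> /(le_trans (x_min _ I)).
rewrite frobNr l2normN frobZr l2normZ gtr0_norm ?invr_gt0// -sqr_l2norm.
have -> : L / 2 * (L^-1 * l2norm (gradient f x)) ^+ 2 =
    L^-1 * l2norm (gradient f x) ^+ 2 / 2 by field; rewrite gt_eqF.
move=> gap_ge; have Linv_gt0 : 0 < L^-1 by rewrite invr_gt0.
rewrite -(ler_pM2l Linv_gt0).
have -> : L^-1 * (2 * L * (f x - f xstar)) = 2 * (f x - f xstar).
  by field; rewrite gt_eqF.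
by lra.
Qed.

(** The Polyak-Lojasiewicz inequality: the quadratic lower bound based at [x] is
    at least f(x) - |g|^2 / 2 mu everywhere, in particular at [xstar]. *)
Lemma gap_le_sqr_gradient {R : realType} {n : nat} (L mu : R)
    (f : 'cV[R]_n -> R) (xstar x : 'cV[R]_n) :
  smooth L f -> 0 < mu -> strongly_convex mu f ->
  2 * mu * (f x - f xstar) <= l2norm (gradient f x) ^+ 2.
Proof.
move=> fL mu_gt0 fmu.
have := strongly_convex_lower_bound L mu f x (xstar - x) fL fmu.
rewrite subrKC -(ler_pM2l mu_gt0); move: (xstar - x) => d.
have := sqr_ge0 (l2norm (gradient f x + mu *: d)).
rewrite [X in 0 <= X -> _]sqr_l2norm !frobE (frobC d) -!sqr_l2norm.
lra.
Qed.

(** Pairing the residual with itself reduces the claim to a real function along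
    the segment, whose derivative grows at rate H|r||d|^2.  Symmetry turns the
    derivative at 0, where the Hessian acts on [r], into one where it acts on
    [d]. *)
Lemma gradient_gap_le_hessian {R : realType} {n : nat} (H : R)
    (f : 'cV[R]_n -> R) (x d : 'cV[R]_n) :
  twice_differentiable f -> 0 <= H -> lipschitz_hessian H f ->
  l2norm (gradient f (x + d) - gradient f x - hessian f x *m d) <=
  H / 2 * l2norm d ^+ 2.
Proof.
move=> f2 H0 fH.
set r := _ - _ - _.
have [->|r0] := eqVneq r 0; first by rewrite l2norm0 mulr_ge0 ?divr_ge0 ?sqr_ge0.
have dG y := @differentiable_frob_gradient _ _ f r y (f2.2 y).
pose phi s := frob (gradient f (x + s *: d)) r.
pose dphi s := frob (hessian f (x + s *: d) *m r) d.
have phiE (t : R) : is_derive t 1 phi (dphi t).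
  rewrite /dphi -gradient_frob_gradient; last exact: f2.2.
  exact: (is_derive_gradient_line (fun z => frob (gradient f z) r) x d t dG).
have dphi_le t : 0 < t -> dphi t <= dphi 0 + H * l2norm r * l2norm d ^+ 2 * t.
  move=> t_gt0; rewrite /dphi scale0r addr0.
  apply: (le_trans (hessian_form_lipschitz H f x (x + t *: d) r d fH)).
  rewrite addrAC subrr add0r l2normZ gtr0_norm// lerD2l.
  by rewrite le_eqVlt; apply/orP; left; apply/eqP; ring.
have r_gt0 : 0 < l2norm r by rewrite l2norm_gt0.
rewrite -(ler_pM2r r_gt0).
have := le_second_order phi dphi _ phiE dphi_le.
rewrite /phi /dphi scale1r scale0r addr0 (hessian_form_sym H f x r d f2 H0 fH).
have : l2norm r ^+ 2 = frob (gradient f (x + d)) r - frob (gradient f x) r -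
    frob (hessian f x *m d) r by rewrite sqr_l2norm {1}/r !frobDl !frobNl.
by lra.
Qed.

(** Strong convexity makes the gradient strongly monotone, and for short
    displacements the gradient is linearized by the Hessian. *)
Lemma hessian_coercive {R : realType} {n : nat} (L mu H : R)
    (f : 'cV[R]_n -> R) (x v : 'cV[R]_n) :
  smooth L f -> strongly_convex mu f ->
  twice_differentiable f -> 0 <= H -> lipschitz_hessian H f ->
  mu * l2norm v ^+ 2 <= frob (hessian f x *m v) v.
Proof.
move=> fL fmu f2 H0 fH.
apply: (@le_of_small _ _ _ (H / 2 * l2norm v ^+ 3)) => t t_gt0 _.
rewrite -(ler_pM2l (mulr_gt0 t_gt0 t_gt0)).
have formE : frob (hessian f x *m (t *: v)) v = t * frob (hessian f x *m v) v.
  by rewrite -scalemxAr frobZl.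
(* Strong monotonicity is the sum of the lower bounds based at x and x + tv. *)
have fwd := strongly_convex_lower_bound L mu f x (t *: v) fL fmu.
have := strongly_convex_lower_bound L mu f (x + t *: v) (- (t *: v)) fL fmu.
rewrite addrK frobNr l2normN.
have := ler_wpM2r (l2norm_ge0 (t *: v))
  (gradient_gap_le_hessian H f x (t *: v) f2 H0 fH).
move=> /(le_trans (frob_CauchySchwarz _ _)); rewrite !frobDl !frobNl.
rewrite !frobZr l2normZ (gtr0_norm t_gt0) ?formE in fwd *.
move: fwd.
generalize (frob (gradient f (x + t *: v)) v) (f (x + t *: v)) => a b.
generalize (frob (hessian f x *m v) v) (frob (gradient f x) v) (f x) (l2norm v).
by move=> ? ? ? ?; lra.
Qed.

Lemma coercive_unitmx {R : realType} {n : nat} (mu : R) (A : 'M[R]_n) :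
  0 < mu -> (forall v : 'cV[R]_n, mu * l2norm v ^+ 2 <= frob (A *m v) v) -> A \in unitmx.
Proof.
move=> mu_gt0 A_ge; rewrite -unitmx_tr -row_free_unit -kermx_eq0.
apply/rowV0P => w /sub_kermxP wA.
have Aw : A *m w^T = 0 by rewrite -[A]trmxK -trmx_mul wA trmx0.
have := A_ge w^T; rewrite Aw frob0l pmulr_rle0// => w_le0.
apply: trmx_inj; apply/eqP; rewrite trmx0 -l2norm_eq0 -sqrf_eq0.
by rewrite eq_le w_le0 sqr_ge0.
Qed.

Lemma coercive_l2norm_le {R : realType} {n : nat} (mu : R) (A : 'M[R]_n)
    (v : 'cV[R]_n) :
  mu * l2norm v ^+ 2 <= frob (A *m v) v -> mu * l2norm v <= l2norm (A *m v).
Proof.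
move=> A_ge; have [->|v0] := eqVneq v 0; first by rewrite l2norm0 mulr0 l2norm_ge0.
rewrite -(@ler_pM2r _ (l2norm v)) ?l2norm_gt0// -mulrA -expr2.
exact: (le_trans A_ge (frob_CauchySchwarz _ _)).
Qed.

(** Multiplying the error of the Newton step by the Hessian [A] at [xstar] gives
    the linearization residual of the gradient, up to sign, because the gradient
    vanishes at [xstar]; coercivity of [A] then bounds the error itself. *)
Lemma newton_step_le {R : realType} {n : nat} (L mu H : R)
    (f : 'cV[R]_n -> R) (xstar x : 'cV[R]_n) :
  smooth L f -> 0 < mu -> strongly_convex mu f ->
  twice_differentiable f -> 0 <= H -> lipschitz_hessian H f ->
  argmin [set: 'cV[R]_n] f xstar ->
  l2norm (x - invmx (hessian f xstar) *m gradient f x - xstar) <=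
  H / (2 * mu) * l2norm (x - xstar) ^+ 2.
Proof.
move=> fL mu_gt0 fmu f2 H0 fH x_min.
set A := hessian f xstar.
have A_ge (v : 'cV[R]_n) : mu * l2norm v ^+ 2 <= frob (A *m v) v.
  exact: (hessian_coercive L mu H).
have A_unit := coercive_unitmx mu A mu_gt0 A_ge.
rewrite addrAC -(ler_pM2l mu_gt0).
apply: (le_trans (coercive_l2norm_le _ _ _ (A_ge _))).
have := gradient_gap_le_hessian H f xstar (x - xstar) f2 H0 fH.
rewrite subrKC (gradient_argmin _ _ _ fL x_min) subr0 -/A.
have -> : A *m (x - xstar - invmx A *m gradient f x) =
    - (gradient f x - A *m (x - xstar)).
  by rewrite [LHS]mulmxBr mulmxA mulmxV// mul1mx opprB.
rewrite l2normN => /le_trans; apply.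
rewrite le_eqVlt; apply/orP; left; apply/eqP.
by field; rewrite gt_eqF.
Qed.

(** * Projected online gradient descent *)

Lemma convex_set_comb {R : realType} {m n : nat} (S : set 'M[R]_(m, n))
    (A B : 'M[R]_(m, n)) (t : R) :
  convex_set S -> S A -> S B -> 0 <= t -> t <= 1 -> S (t *: A + (1 - t) *: B).
Proof.
move=> cS SA SB t0 t1.
by have /set_mem := cS A B (Itv01 t0 t1) (mem_set SA) (mem_set SB).
Qed.

(** Comparing the projection [B] with points of the segment towards [C] shows
    that A - B and C - B make an obtuse angle. *)
Lemma proj_l2norm_le {R : realType} {m n : nat} (S : set 'M[R]_(m, n))
    (A B C : 'M[R]_(m, n)) :
  convex_set S -> is_proj S A B -> S C ->
  l2norm (B - C) ^+ 2 <= l2norm (A - C) ^+ 2.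
Proof.
move=> cS [SB B_min] SC.
have obtuse : 2 * frob (A - B) (C - B) <= 0.
  apply: (@le_of_small _ _ _ (l2norm (C - B) ^+ 2)) => t t_gt0 t_le1.
  have stepE : A - (t *: C + (1 - t) *: B) = (A - B) - t *: (C - B).
    by rewrite scalerBl scale1r scalerBr addrCA opprD addrA.
  have near : l2norm (A - B) ^+ 2 <= l2norm ((A - B) - t *: (C - B)) ^+ 2.
    rewrite ler_sqr ?nnegrE ?l2norm_ge0// -stepE.
    exact: B_min (convex_set_comb S C B t cS SC SB (ltW t_gt0) t_le1).
  rewrite -(ler_pM2l t_gt0); move: near; rewrite !sqr_l2norm.
  by move: (A - B) (C - B) => U V; rewrite !frobE (frobC V U); lra.
have -> : A - C = (A - B) - (C - B) by rewrite opprB addrA subrK.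
rewrite -[B - C]opprB l2normN !sqr_l2norm.
move: obtuse (sqr_ge0 (l2norm (A - B))); rewrite sqr_l2norm.
by move: (A - B) (C - B) => U V; rewrite !frobE (frobC V U); lra.
Qed.

Lemma l2norm_le_diam {R : realType} {m n : nat} (S : set 'M[R]_(m, n)) (D : R)
    (A B : 'M[R]_(m, n)) :
  (diam S <= D%:E)%E -> S A -> S B -> l2norm (A - B) <= D.
Proof.
move=> SD SA SB; rewrite -lee_fin; apply: le_trans SD.
by apply: ereal_sup_ubound; exists A => //; exists B.
Qed.

(** The squared distance to the comparator drops at each step by
    at least 2 eta <G_k, P_k - Q> - eta^2 B^2; these drops telescope. *)
Lemma projected_gradient_regret {R : realType} {m n : nat}
    (S : set 'M[R]_(m, n)) (P G : nat -> 'M[R]_(m, n)) (Q : 'M[R]_(m, n))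
    (eta B : R) (K : nat) :
  convex_set S -> S Q -> 0 < eta ->
  (forall k, (1 <= k <= K)%N -> l2norm (G k) <= B) ->
  (forall k, (1 <= k <= K)%N -> is_proj S (P k - eta *: G k) (P k.+1)) ->
  \sum_(1 <= k < K.+1) frob (G k) (P k - Q) <=
  l2norm (P 1%N - Q) ^+ 2 / (2 * eta) + K%:R * (eta * B ^+ 2 / 2).
Proof.
move=> cS SQ eta_gt0 G_le P_proj.
have step k : (1 <= k <= K)%N -> frob (G k) (P k - Q) <=
    l2norm (P k - Q) ^+ 2 / (2 * eta) - l2norm (P k.+1 - Q) ^+ 2 / (2 * eta) +
    eta * B ^+ 2 / 2.
  move=> kK; have := proj_l2norm_le S _ _ Q cS (P_proj k kK) SQ.
  have G2_le : l2norm (G k) ^+ 2 <= B ^+ 2.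
    have Gk_le := G_le k kK; have B_ge0 := le_trans (l2norm_ge0 _) Gk_le.
    by rewrite ler_sqr ?nnegrE ?l2norm_ge0.
  rewrite addrAC [X in _ <= X -> _]sqr_l2norm.
  move: (P k - Q) => U; rewrite !frobE (frobC U) -!sqr_l2norm.
  move=> proj_le; rewrite -(ler_pM2l (mulr_gt0 (ltr0n R 2) eta_gt0)).
  have -> : 2 * eta * (l2norm U ^+ 2 / (2 * eta) -
      l2norm (P k.+1 - Q) ^+ 2 / (2 * eta) + eta * B ^+ 2 / 2) =
    l2norm U ^+ 2 - l2norm (P k.+1 - Q) ^+ 2 + eta * eta * B ^+ 2.
    by field; rewrite gt_eqF.
  have := ler_wpM2l (mulr_ge0 (ltW eta_gt0) (ltW eta_gt0)) G2_le.
  by move: proj_le; lra.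
suff partial j : (j <= K)%N -> \sum_(1 <= k < j.+1) frob (G k) (P k - Q) <=
    l2norm (P 1%N - Q) ^+ 2 / (2 * eta) - l2norm (P j.+1 - Q) ^+ 2 / (2 * eta) +
    j%:R * (eta * B ^+ 2 / 2).
  apply: (le_trans (partial K (leqnn K))); rewrite lerD2r gerBl.
  by rewrite divr_ge0 ?sqr_ge0// mulr_ge0 ?(ltW eta_gt0).
elim: j => [|j IHj] jK; first by rewrite big_nil subrr mul0r addr0.
rewrite big_nat_recr//=; apply: (le_trans (lerD (IHj (ltnW jK)) (step j.+1 _))).
  by rewrite jK.
by rewrite -[j.+1%:R]natr1; lra.
Qed.

(** * Hypergradient feedback *)

(** The feedback is [f] composed with an affine map of the matrix, up to
    constants, so it inherits the first-order inequality of [f]. *)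
Lemma feedback_subgradient {R : realType} {n : nat} (L mu : R)
    (f : 'cV[R]_n -> R) (x : 'cV[R]_n) (P Q : 'M[R]_n) :
  smooth L f -> 0 <= mu -> strongly_convex mu f ->
  feedback f x P - feedback f x Q <= frob (gradient (feedback f x) P) (P - Q).
Proof.
move=> fL mu_ge0 fmu; rewrite gradient_feedback; last exact: fL.1.
rewrite frobZl frob_mulmxr trmxK /feedback -mulrBl mulrC mulNr -mulrN.
rewrite ler_wpM2l ?invr_ge0 ?sqr_ge0//.
have := strongly_convex_first_order L mu f (x - P *m gradient f x)
  ((P - Q) *m gradient f x) fL mu_ge0 fmu.
have -> : x - P *m gradient f x + (P - Q) *m gradient f x =
    x - Q *m gradient f x by rewrite mulmxBl addrA subrK.
by move: (frob _ _) (f (x - Q *m _)) (f (x - P *m _)) => a b c; lra.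
Qed.

Lemma l2norm_gradient_feedback {R : realType} {n : nat} (L D : R)
    (f : 'cV[R]_n -> R) (x : 'cV[R]_n) (P : 'M[R]_n) :
  smooth L f -> 0 <= L -> gradient f x != 0 -> l2norm P <= D ->
  l2norm (gradient (feedback f x) P) <= L * D + 1.
Proof.
move=> fL L_ge0 g0 P_le; rewrite gradient_feedback; last exact: fL.1.
have g_gt0 : 0 < l2norm (gradient f x) by rewrite l2norm_gt0.
rewrite l2normZ normrN ger0_norm ?invr_ge0 ?sqr_ge0// l2norm_outer.
set u := gradient f (x - _).
have u_le : l2norm u <= (L * D + 1) * l2norm (gradient f x).
  rewrite -[u](subrK (gradient f x)) mulrDl mul1r.
  apply: (le_trans (l2normD _ _)); rewrite lerD2r -mulrA.
  apply: (le_trans (fL.2 _ _)); rewrite ler_wpM2l//.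
  rewrite addrAC subrr add0r l2normN.
  by apply: (le_trans (l2norm_mulmx _ _)); rewrite ler_wpM2r ?l2norm_ge0.
rewrite mulrC ler_pdivrMr ?exprn_gt0// expr2 mulrA.
by rewrite ler_wpM2r ?l2norm_ge0.
Qed.

(** The arithmetic-geometric mean inequality turns the product of the factors
    into a quantity that is controlled by their sum. *)
Lemma prod_rates_le {R : realType} (e r : nat -> R) (K : nat) :
  0 <= e 1%N -> (forall k, (1 <= k <= K)%N -> 0 <= r k) ->
  (forall k, (1 <= k <= K)%N -> e k.+1 <= e k * r k) ->
  e K.+1 <= e 1%N * ((\sum_(1 <= k < K.+1) r k) / K%:R) ^+ K.
Proof.
move=> e1 r_ge0 e_le.
have prod_le j : (j <= K)%N -> e j.+1 <= e 1%N * \prod_(1 <= k < j.+1) r k.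
  elim: j => [|j IHj] jK; first by rewrite big_nil mulr1.
  rewrite big_nat_recr//= mulrA; apply: (le_trans (e_le j.+1 _)); first by rewrite jK.
  by rewrite ler_wpM2r ?r_ge0 ?jK ?IHj ?(ltnW jK).
apply: (le_trans (prod_le K (leqnn K))); rewrite ler_wpM2l//.
rewrite !big_add1 /= !big_mkord.
have := @leif_AGM R 'I_K 'I_K (fun i => r i.+1) (fun i _ => r_ge0 i.+1 (ltn_ord i)).
by rewrite card_ord => -[].
Qed.

(** * Convergence of hypergradient descent *)

Lemma smooth_ge_strong_convexity {R : realType} {n : nat} (L mu : R)
    (f : 'cV[R]_n -> R) (xstar x : 'cV[R]_n) :
  smooth L f -> strongly_convex mu f -> argmin [set: 'cV[R]_n] f xstar ->
  x <> xstar -> mu <= L.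
Proof.
move=> fL fmu x_min x_neq.
have d_gt0 : 0 < l2norm (x - xstar) ^+ 2.
  by rewrite exprn_gt0// l2norm_gt0 subr_eq0; exact/eqP.
have := le_trans (gap_lower L mu f xstar x fL fmu x_min)
  (gap_upper L f xstar x fL x_min).
by rewrite ler_pM2r//; lra.
Qed.

Lemma lipschitz_hessian_ge0 {R : realType} {n : nat} (H : R)
    (f : 'cV[R]_n -> R) (x y : 'cV[R]_n) :
  lipschitz_hessian H f -> x <> y -> 0 <= H.
Proof.
move=> fH x_neq.
have d_gt0 : 0 < l2norm (x - y) by rewrite l2norm_gt0 subr_eq0; exact/eqP.
have op_ge0 := le_trans (l2norm_ge0 _)
  (l2norm_mulmx_opnorm (hessian f x - hessian f y) (x - y)).
rewrite pmulr_lge0// in op_ge0.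
by have := le_trans op_ge0 (fH x y); rewrite pmulr_lge0.
Qed.

(** After the step the gap is at most L/2 times the square of the Newton error,
    and the normalization |g|^2 is at least mu^2 |x - x*|^2. *)
Lemma newton_rate {R : realType} {n : nat} (L mu H : R)
    (f : 'cV[R]_n -> R) (xstar x : 'cV[R]_n) :
  smooth L f -> 0 < mu -> strongly_convex mu f ->
  twice_differentiable f -> 0 <= H -> lipschitz_hessian H f ->
  argmin [set: 'cV[R]_n] f xstar -> x <> xstar ->
  2 * L * ((f (x - invmx (hessian f xstar) *m gradient f x) - f xstar) /
    l2norm (gradient f x) ^+ 2) <=
  H ^+ 2 * (L / mu) ^+ 2 / (4 * mu ^+ 2) * l2norm (x - xstar) ^+ 2.
Proof.
move=> fL mu_gt0 fmu f2 H0 fH x_min x_neq.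
have L_gt0 : 0 < L.
  apply: lt_le_trans mu_gt0 _.
  exact: smooth_ge_strong_convexity L mu f xstar x fL fmu x_min x_neq.
have d_gt0 : 0 < l2norm (x - xstar).
  by rewrite l2norm_gt0 subr_eq0; exact/eqP.
have gap_le := gap_le_sqr_gradient L mu f xstar x fL mu_gt0 fmu.
have gap_ge := gap_lower L mu f xstar x fL fmu x_min.
have grad_ge : mu ^+ 2 * l2norm (x - xstar) ^+ 2 <= l2norm (gradient f x) ^+ 2.
  by apply: le_trans gap_le; have := ler_wpM2l (ltW mu_gt0) gap_ge; lra.
have newton := newton_step_le L mu H f xstar x fL mu_gt0 fmu f2 H0 fH x_min.
have := gap_upper L f xstar (x - invmx (hessian f xstar) *m gradient f x) fL x_min.
have : l2norm (x - invmx (hessian f xstar) *m gradient f x - xstar) ^+ 2 <=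
    (H / (2 * mu) * l2norm (x - xstar) ^+ 2) ^+ 2.
  by rewrite ler_sqr ?nnegrE ?l2norm_ge0// (le_trans (l2norm_ge0 _) newton).
have g_gt0 : 0 < l2norm (gradient f x) ^+ 2.
  by apply: lt_le_trans grad_ge; rewrite mulr_gt0 ?exprn_gt0.
clear newton gap_le gap_ge.
move: (l2norm (gradient f x) ^+ 2) g_gt0 grad_ge => G G_gt0 G_ge.
move: (l2norm (x - xstar)) d_gt0 G_ge => d d_gt0 G_ge.
move: (l2norm _ ^+ 2) (f _ - f xstar) => s a s_le a_le.
rewrite mulrA ler_pdivrMr//.
have a_le' : a <= L / 2 * (H / (2 * mu) * d ^+ 2) ^+ 2.
  by apply: (le_trans a_le); rewrite ler_wpM2l// divr_ge0// ltW.
apply: (@le_trans _ _ (2 * L * (L / 2 * (H / (2 * mu) * d ^+ 2) ^+ 2))).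
  by rewrite ler_wpM2l// mulr_ge0// ltW.
have coef_ge0 : 0 <= H ^+ 2 * (L / mu) ^+ 2 / (4 * mu ^+ 2) * d ^+ 2.
  by rewrite mulr_ge0 ?sqr_ge0// divr_ge0// mulr_ge0 ?sqr_ge0.
apply: le_trans (ler_wpM2l coef_ge0 G_ge).
by rewrite le_eqVlt; apply/orP; left; apply/eqP; field; rewrite gt_eqF.
Qed.

Theorem theorem3p3 (R : realType) (n : nat) (f : 'cV[R]_n -> R)
    (L mu H : R) (xstar : 'cV[R]_n) (PP : set 'M[R]_n) (D : R) (K : nat)
    (x : nat -> 'cV[R]_n) (P : nat -> 'M[R]_n)
    (f_smooth : smooth L f)
    (mu_gt0 : 0 < mu)
    (f_sconvex : strongly_convex mu f)
    (f_diff2 : twice_differentiable f)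
    (f_hessian : lipschitz_hessian H f)
    (xstar_min : argmin [set: 'cV[R]_n] f xstar)
    (PP_closed : closed PP)
    (PP_convex : convex_set PP)
    (PP_0 : PP 0)
    (PP_L : PP (L^-1)%:M)
    (PP_diam : (diam PP <= D%:E)%E)
    (PP_hessian : PP (invmx (hessian f xstar)))
    (K_ge1 : (1 <= K)%N)
    (x_HDM : HDM f PP (fun _ => D / ((L * D + 1) * Num.sqrt K%:R)) K x P)
    (x_neq : forall k : nat, (1 <= k <= K)%N -> x k <> xstar) :
  let kappa := L / mu in
  let rho := D * (L * D + 1) * Num.sqrt K%:R in
  f (x K.+1) - f xstar <=
  (f (x 1%N) - f xstar) *
  Num.min
    (H ^+ 2 * kappa ^+ 2 / (4 * mu ^+ 2 * K%:R) *
       (\sum_(1 <= k < K.+1) l2norm (x k - xstar) ^+ 2)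
     + 2 * L * rho / K%:R)
    1 ^+ K.
Proof.
lazy zeta; set kappa := L / mu; set rho := D * (L * D + 1) * Num.sqrt K%:R.
have x1_neq : x 1%N <> xstar by apply: x_neq; rewrite K_ge1.
have mu_le_L := smooth_ge_strong_convexity L mu f xstar (x 1%N) f_smooth f_sconvex
  xstar_min x1_neq.
have L_gt0 : 0 < L := lt_le_trans mu_gt0 mu_le_L.
have H_ge0 := lipschitz_hessian_ge0 H f _ _ f_hessian x1_neq.
have K_gt0 : (0 : R) < K%:R by rewrite ltr0n.
have sqrtK_gt0 : 0 < Num.sqrt (K%:R : R) by rewrite sqrtr_gt0.
(* D is at least the norm of I / L, which is nonzero in positive dimension. *)
have D_gt0 : 0 < D.
  apply: lt_le_trans (l2norm_le_diam PP D _ _ PP_diam PP_L PP_0).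
  rewrite l2norm_gt0 subr0; apply: contra_notN x1_neq => /eqP LI0.
  have : L^-1 *: (x 1%N - xstar) = 0 by rewrite -mul_scalar_mx LI0 mul0mx.
  by move=> /eqP; rewrite scaler_eq0 invr_eq0 gt_eqF//= subr_eq0 => /eqP.
have [PP_1 HDM_step] := x_HDM.
set eta := D / _ in HDM_step.
have B_gt0 : 0 < L * D + 1 by rewrite ltr_wpDl// mulr_ge0// ltW.
have eta_gt0 : 0 < eta by rewrite divr_gt0// mulr_gt0.
set Q := invmx (hessian f xstar) in PP_hessian.
have PP_P k : (1 <= k <= K)%N -> PP (P k).
  case: k => [//|[|k]] //= kK.
  by have [_ []] := HDM_step k.+1 (ltnW kK).
have gap_ge0 y : 0 <= f y - f xstar by rewrite subr_ge0; exact: xstar_min.2.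
have grad_gt0 k : (1 <= k <= K)%N -> 0 < l2norm (gradient f (x k)) ^+ 2.
  move=> kK; have PL := gap_le_sqr_gradient L mu f xstar (x k) f_smooth mu_gt0 f_sconvex.
  apply: lt_le_trans PL.
  apply: mulr_gt0; first exact: mulr_gt0.
  apply: lt_le_trans (gap_lower L mu f xstar (x k) f_smooth f_sconvex xstar_min).
  rewrite mulr_gt0 ?divr_gt0// exprn_gt0// l2norm_gt0 subr_eq0.
  exact/eqP/x_neq.
pose rate (M : 'M[R]_n) k := (f (x k - M *m gradient f (x k)) - f xstar) /
  l2norm (gradient f (x k)) ^+ 2.
have regret : \sum_(1 <= k < K.+1) (rate (P k) k - rate Q k) <= rho.
  have rateB k : rate (P k) k - rate Q k =
      feedback f (x k) (P k) - feedback f (x k) Q.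
    by rewrite /rate /feedback -!mulrBl; congr (_ / _); ring.
  have K_sqr : K%:R = Num.sqrt K%:R ^+ 2 :> R by rewrite sqr_sqrtr// ltW.
  have G_le k : (1 <= k <= K)%N ->
      l2norm (gradient (feedback f (x k)) (P k)) <= L * D + 1.
    move=> kK; apply: (l2norm_gradient_feedback _ _ _ _ _ f_smooth (ltW L_gt0)).
      by rewrite -l2norm_eq0 -sqrf_eq0 gt_eqF// grad_gt0.
    by rewrite -[P k]subr0; exact: l2norm_le_diam PP_diam (PP_P k kK) PP_0.
  have := projected_gradient_regret PP P
    (fun k => gradient (feedback f (x k)) (P k)) Q eta (L * D + 1) K
    PP_convex PP_hessian eta_gt0 G_le (fun k kK => (HDM_step k kK).2).
  move=> ogd; apply: (le_trans (ler_sum_nat _)).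
    move=> k kK; rewrite rateB.
    exact: feedback_subgradient f_smooth (ltW mu_gt0) f_sconvex.
  apply: (le_trans ogd); rewrite K_sqr.
  have P1_le : l2norm (P 1%N - Q) ^+ 2 <= D ^+ 2.
    have := l2norm_le_diam PP D _ _ PP_diam PP_1 PP_hessian.
    by rewrite ler_sqr ?nnegrE ?l2norm_ge0// ltW.
  (* The step size eta balances the two terms of the regret: each is rho / 2. *)
  apply: (@le_trans _ _ (D ^+ 2 / (2 * eta) +
      Num.sqrt K%:R ^+ 2 * (eta * (L * D + 1) ^+ 2 / 2))).
    by rewrite lerD2r ler_wpM2r// invr_ge0 mulr_ge0// ltW.
  rewrite /rho /eta le_eqVlt; apply/orP; left; apply/eqP.
  by field; rewrite !gt_eqF.
have rate_ge0 M k : 0 <= rate M k by rewrite divr_ge0 ?sqr_ge0.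
have descent k : (1 <= k <= K)%N -> f (x k.+1) - f xstar <=
    (f (x k) - f xstar) * Num.min (2 * L * rate (P k) k) 1.
  move=> kK; have [[_ f_min] _] := HDM_step k kK.
  rewrite minr_pMr ?gap_ge0// le_min mulr1 lerD2r (f_min (x k)) ?andbT; last by left.
  apply: (@le_trans _ _ (rate (P k) k * l2norm (gradient f (x k)) ^+ 2)).
    by rewrite divfK ?gt_eqF ?grad_gt0// lerD2r; apply: f_min; right.
  have -> : (f (x k) - f xstar) * (2 * L * rate (P k) k) =
    rate (P k) k * (2 * L * (f (x k) - f xstar)) by ring.
  apply: ler_wpM2l => //.
  exact: sqr_gradient_le_gap L f xstar (x k) L_gt0 f_smooth xstar_min.
have r_ge0 k : (1 <= k <= K)%N -> 0 <= Num.min (2 * L * rate (P k) k) 1.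
  move=> _; rewrite le_min ler01 andbT; apply: mulr_ge0 => //.
  by apply: mulr_ge0 => //; exact: ltW.
apply: (le_trans (prod_rates_le (fun k => f (x k) - f xstar)
  _ K (gap_ge0 _) r_ge0 descent)).
set total := \sum_(1 <= k < K.+1) Num.min _ _.
have total_ge0 : 0 <= total.
  by rewrite /total big_nat_cond sumr_ge0// => k /andP[kK _]; exact: r_ge0.
have total_leK : total <= K%:R.
  apply: (@le_trans _ _ (\sum_(1 <= k < K.+1) 1)).
    by apply: ler_sum_nat => k _; rewrite ge_min lexx orbT.
  by rewrite sumr_const_nat subn1.
have newton k : (1 <= k <= K)%N -> 2 * L * rate Q k <=
    H ^+ 2 * kappa ^+ 2 / (4 * mu ^+ 2) * l2norm (x k - xstar) ^+ 2.
  by move=> kK; exact: newton_rate (x_neq k kK).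
have total_le : total <= H ^+ 2 * kappa ^+ 2 / (4 * mu ^+ 2) *
    (\sum_(1 <= k < K.+1) l2norm (x k - xstar) ^+ 2) + 2 * L * rho.
  apply: (@le_trans _ _ (\sum_(1 <= k < K.+1)
    (H ^+ 2 * kappa ^+ 2 / (4 * mu ^+ 2) * l2norm (x k - xstar) ^+ 2 +
     2 * L * (rate (P k) k - rate Q k)))).
    apply: ler_sum_nat => k kK; rewrite ge_min; apply/orP; left.
    by have := newton k kK; lra.
  by rewrite big_split /= -!mulr_sumr lerD2l ler_wpM2l// mulr_ge0// ltW.
have avg_le : total / K%:R <= Num.min (H ^+ 2 * kappa ^+ 2 / (4 * mu ^+ 2 * K%:R) *
    (\sum_(1 <= k < K.+1) l2norm (x k - xstar) ^+ 2) + 2 * L * rho / K%:R) 1.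
  rewrite le_min !ler_pdivrMr// mul1r total_leK andbT.
  apply: (le_trans total_le); rewrite le_eqVlt; apply/orP; left; apply/eqP.
  by field; rewrite !gt_eqF.
have avg_ge0 : 0 <= total / K%:R by rewrite divr_ge0// ltW.
apply: ler_wpM2l => //; apply: lerXn2r => //.
exact: le_trans avg_ge0 avg_le.
Qed.
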